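(* There is an algorithm that, given a cyclic arrangement $(c_1,\dots,c_m)$ of a set $C$ of $m$ candidates and a ranking $v\in\mathcal{L}(C)$, computes $\mathrm{swap}(\mathrm{SPOC},v)$ in time $O(m^2)$, where $\mathrm{SPOC}\subseteq\mathcal{L}(C)$ is the domain of all rankings that are single-peaked with respect to the cycle $(c_1,\dots,c_m)$.
   Context: $\mathcal{L}(C)$ is the set of all linear orders (rankings, votes) over $C$. The swap distance $\mathrm{swap}(u,v)$ is the number of unordered pairs of candidates whose relative order differs in $u$ and $v$. For a set of rankings $D$, $\mathrm{swap}(D,v)=\min_{u\in D}\mathrm{swap}(u,v)$. A ranking $v$ is single-peaked with respect to a connected undirected graph $G$ with vertex set $C$ if for every $t\in\{1,\dots,m\}$ the subgraph of $G$ induced by the $t$ top-ranked candidates of $v$ is connected. SPOC (single-peaked on a circle) is the case where $G$ is the cycle through $c_1,c_2,\dots,c_m$ in this order (with $c_m$ adjacent to $c_1$). *)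

(* Defs.v *)
From mathcomp Require Import all_boot.

Set Implicit Arguments.
Unset Strict Implicit.
Unset Printing Implicit Defensive.

(* A linear order over C is the list of all its elements, top-ranked first: a
   duplicate-free #|C|-tuple contains every element of C. *)
Definition linear_orders (C : finType) : {set #|C|.-tuple C} :=
  [set v : #|C|.-tuple C | uniq v].

Definition prefers (C : finType) (v : seq C) (a b : C) : bool :=
  index a v < index b v.

Definition swap_dist (C : finType) (u v : seq C) : nat :=
  #|[set P : {set C} | [exists a, exists b,
      [&& P == [set a; b], prefers u a b & prefers v b a]]]|.

(* No swap distance exceeds 'C(#|C|, 2), so as soon as D is nonempty the
   default value of the iterated minimum is irrelevant; see swap_domP. *)
Definition swap_dom (C : finType) (D : {set #|C|.-tuple C}) (v : seq C) : nat :=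
  \big[minn/'C(#|C|, 2)]_(u in D) swap_dist u v.

Definition connected_in (C : finType) (e : rel C) (S : {set C}) : bool :=
  [forall x in S, forall y in S,
     connect [rel a b | [&& a \in S, b \in S & e a b]] x y].

(* t : 'I_#|C| ranges over 0, ..., #|C| - 1, hence t.+1 over 1, ..., #|C|. *)
Definition single_peaked (C : finType) (e : rel C) (v : seq C) : bool :=
  [forall t : 'I_#|C|, connected_in e [set x in take t.+1 v]].

(* path.next is cyclic: the successor of the last item of c is the first. *)
Definition cycle_graph (C : finType) (c : seq C) : rel C :=
  [rel x y | (next c x == y) || (next c y == x)].

Definition SPOC (C : finType) (c : seq C) : {set #|C|.-tuple C} :=
  [set v in linear_orders C | single_peaked (cycle_graph c) v].

(* Uniform-cost random access machine, as a structured language with nat-valued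
   scalar variables and arrays.  A program mentions finitely many variables and
   arrays.  Every constant, variable access, array access, addition,
   (truncated) subtraction, assignment and branch test costs one unit.  There
   is no unit-cost multiplication. *)

Record state := State { reg : nat -> nat; arr : nat -> nat -> nat }.

Definition upd (T : Type) (f : nat -> T) (i : nat) (y : T) : nat -> T :=
  fun j => if j == i then y else f j.

Inductive expr :=
  | Cst of nat
  | Var of nat
  | Get of nat & expr
  | Add of expr & expr
  | Sub of expr & expr.

Fixpoint eval (s : state) (e : expr) : nat :=
  match e with
  | Cst n => n
  | Var x => reg s x
  | Get a e1 => arr s a (eval s e1)
  | Add e1 e2 => eval s e1 + eval s e2
  | Sub e1 e2 => eval s e1 - eval s e2
  end.

Fixpoint ecost (e : expr) : nat :=
  match e with
  | Cst _ | Var _ => 1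
  | Get _ e1 => (ecost e1).+1
  | Add e1 e2 | Sub e1 e2 => (ecost e1 + ecost e2).+1
  end.

Inductive cmd :=
  | Skip
  | Set_ of nat & expr
  | Put of nat & expr & expr
  | Seq of cmd & cmd
  | If of expr & cmd & cmd
  | While of expr & cmd.

(* exec p s t s' : started in s, p halts in s' after exactly t units of time.
   A test succeeds when its value is nonzero. *)
Inductive exec : cmd -> state -> nat -> state -> Prop :=
  | ExecSkip s :
      exec Skip s 1 s
  | ExecSet s x e :
      exec (Set_ x e) s (ecost e).+1
        (State (upd (reg s) x (eval s e)) (arr s))
  | ExecPut s a e1 e2 :
      exec (Put a e1 e2) s (ecost e1 + ecost e2).+1
        (State (reg s)
           (upd (arr s) a (upd (arr s a) (eval s e1) (eval s e2))))
  | ExecSeq p q s t s1 t1 s2 :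
      exec p s t s1 -> exec q s1 t1 s2 -> exec (Seq p q) s (t + t1) s2
  | ExecIfT e p q s t s1 :
      eval s e != 0 -> exec p s t s1 -> exec (If e p q) s (ecost e + t).+1 s1
  | ExecIfF e p q s t s1 :
      eval s e = 0 -> exec q s t s1 -> exec (If e p q) s (ecost e + t).+1 s1
  | ExecWhileT e p s t s1 t1 s2 :
      eval s e != 0 -> exec p s t s1 -> exec (While e p) s1 t1 s2 ->
      exec (While e p) s (ecost e + t + t1).+1 s2
  | ExecWhileF e p s :
      eval s e = 0 -> exec (While e p) s (ecost e).+1 s.

Definition big_O (f g : nat -> nat) : Prop :=
  exists K n0 : nat, forall n, n0 <= n -> f n <= K * g n.

(* Initial state: variable 0 holds the number m of candidates, array 0 the
   cyclic arrangement and array 1 the ranking, each candidate x being given by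
   its number code x < m; everything else is 0. *)
Definition input (C : finType) (code : C -> 'I_#|C|) (c v : seq C) : state :=
  {| reg := fun x => if x == 0 then #|C| else 0;
     arr := fun a i =>
       if a == 0 then nth 0 [seq (code x : nat) | x <- c] i
       else if a == 1 then nth 0 [seq (code x : nat) | x <- v] i
       else 0 |}.

Definition output (s : state) : nat := reg s 0.

Lemma swap_dist_le (C : finType) (u v : seq C) :
  swap_dist u v <= 'C(#|C|, 2).
Proof.
rewrite -cardsT -[X in _ <= X]cards_draws; apply/subset_leq_card/subsetP => P.
rewrite !inE => /existsP[a /existsP[b /and3P[/eqP-> ab _]]].
by rewrite subsetT cards2 (contraTneq _ ab) // => ->; rewrite /prefers ltnn.
Qed.

Lemma swap_domP (C : finType) (D : {set #|C|.-tuple C}) (v : seq C) :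
  D != set0 ->
  (exists2 u, u \in D & swap_dom D v = swap_dist u v) /\
  (forall u, u \in D -> swap_dom D v <= swap_dist u v).
Proof.
have lb u : u \in D -> swap_dom D v <= swap_dist u v.
  rewrite /swap_dom => uD; elim: index_enum (mem_index_enum u) => // w r IH.
  rewrite inE big_cons => /predU1P[<-|/IH le_r]; first by rewrite uD geq_minl.
  by case: ifP => // _; rewrite geq_min le_r orbT.
case/set0Pn=> u0 u0D; split=> //.
have : swap_dom D v = 'C(#|C|, 2) \/
       exists2 u, u \in D & swap_dom D v = swap_dist u v.
  rewrite /swap_dom; elim/big_ind: _ => [|x y|u uD]; first by left.
    by rewrite /minn; case: ifP.
  by right; exists u.
case=> // E; exists u0 => //; apply/eqP.
by rewrite eqn_leq lb // E swap_dist_le.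
Qed.

Lemma cycle_graph_sym (C : finType) (c : seq C) : symmetric (cycle_graph c).
Proof. by move=> x y; rewrite /cycle_graph /= orbC. Qed.

Lemma mem_SPOC_arrangement (C : finType) (c : #|C|.-tuple C) :
  uniq c -> c \in SPOC c.
Proof.
move=> Uc; rewrite !inE Uc; apply/forallP=> t.
set S := [set _ in _].
pose r := [rel a b | [&& a \in S, b \in S & cycle_graph c a b]].
rewrite -[connected_in _ _]/[forall x in S, forall y in S, connect r x y].
have rC : symmetric r.
  by move=> a b; rewrite /r [LHS]/= cycle_graph_sym andbCA.
have [x0 _|S0] := pickP (mem S); last first.
  by apply/forall_inP=> x; rewrite [_ \in _]S0.
pose z := nth x0 c 0.
have inS i : i <= t -> nth x0 c i \in S.
  move=> it; rewrite inE -(nth_take x0 (n0 := t.+1)) // mem_nth //.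
  by rewrite size_takel // size_tuple ltn_ord.
have zr i : i <= t -> connect r z (nth x0 c i).
  elim: i => [|i IH] it; first exact: connect0.
  apply: connect_trans (IH (ltnW it)) (connect1 _).
  rewrite /r /= !inS ?(ltnW it) //= /cycle_graph /= next_nth.
  have ic : i.+1 < size c by rewrite size_tuple (leq_ltn_trans it).
  rewrite mem_nth ?(ltnW ic) // index_uniq ?(ltnW ic) //.
  case: (val c) ic => //= y p ip.
  by rewrite (set_nth_default x0) ?eqxx.
have zS x : x \in S -> connect r z x.
  rewrite inE => xS; have := xS; rewrite -index_mem size_takel; last first.
    by rewrite size_tuple ltn_ord.
  move=> it; have := zr _ it.
  by rewrite -(nth_take x0 it) nth_index.
apply/forall_inP=> x xS; apply/forall_inP=> y yS.
apply: connect_trans (zS y yS); rewrite (sym_connect_sym rC).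
exact: zS.
Qed.

Lemma exec_det p s t s' : exec p s t s' ->
  forall t1 s1, exec p s t1 s1 -> t1 = t /\ s1 = s'.
Proof.
elim=> {p s t s'} => [s|s x e|s a e1 e2|p q s t s1 t1 s2 _ IHp _ IHq
  |e p q s t s1 e0 _ IH|e p q s t s1 e0 _ IH|e p s t s1 t1 s2 e0 _ IHp _ IHw
  |e p s e0] t' s' H; inversion H; subst=> //;
  try by (match goal with A : is_true (eval ?s ?e != 0), B : eval ?s ?e = 0 |- _
          => by rewrite B in A end).
- match goal with A : exec p s _ _ |- _ => case: (IHp _ _ A) => ? ? end; subst.
  by match goal with A : exec q _ _ _ |- _ => case: (IHq _ _ A) => -> -> end.
- by match goal with A : exec p s _ _ |- _ => case: (IH _ _ A) => -> -> end.
- by match goal with A : exec q s _ _ |- _ => case: (IH _ _ A) => -> -> end.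
- match goal with A : exec p s _ _ |- _ => case: (IHp _ _ A) => ? ? end; subst.
  by match goal with A : exec (While _ _) _ _ _ |- _ =>
    case: (IHw _ _ A) => -> -> end.
Qed.

(* Main.v *)
(* The prefixes of a ranking that is single-peaked on a circle are arcs, each
   extending the previous one at one of its two ends, and the swaps caused by
   ranking x next are counted by the members y of the current arc such that v
   prefers x to y.  Hence the cheapest way to build the arc of length l starting
   at i satisfies
     D(l+1, i) = min (D(l, i) + R(l, i)) (D(l, i+1) + L(l, i)),
   where R and L count the swaps of a right and of a left extension, and the
   distance is the minimum of D(m, i) over i.  As R(l+1, i) - R(l, i+1) and
   L(l+1, i) - L(l, i) depend on a single comparison between the two ends of the
   arc, each of the O(m^2) states takes constant time. *)

Require Import Defs.
From mathcomp Require Import all_boot zify.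

Set Implicit Arguments.
Unset Strict Implicit.
Unset Printing Implicit Defensive.

(** * Costs of growing arcs *)

Definition gain_right (w : nat -> nat) (l i : nat) : nat :=
  count (fun k => w (i + l) < w k) (iota i l).

(** The arc being extended starts at [i.+1] here and at [i] in [gain_right], so both extensions end
    in the arc of length [l.+1] starting at [i]. *)
Definition gain_left (w : nat -> nat) (l i : nat) : nat :=
  count (fun k => w i < w k) (iota i.+1 l).

Fixpoint arc_cost (w : nat -> nat) (l i : nat) : nat :=
  if l is l'.+1 then
    minn (arc_cost w l' i + gain_right w l' i)
         (arc_cost w l' i.+1 + gain_left w l' i)
  else 0.

Lemma gain_rightS w l i :
  gain_right w l.+1 i = gain_right w l i.+1 + (w (i + l.+1) < w i).
Proof. by rewrite /gain_right /= addSnnS addnC. Qed.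

Lemma gain_leftS w l i :
  gain_left w l.+1 i = gain_left w l i + (w i < w (i + l.+1)).
Proof. by rewrite /gain_left -(addn1 l) iotaD count_cat /= addn0 addSnnS addn1. Qed.

(** * Arcs on the circle *)

Definition arc (C : finType) (x0 : C) (c : seq C) (i l : nat) : seq C :=
  [seq nth x0 c (k %% size c) | k <- iota i l].

(** Reading from a list of ranks with default [0] requires no default candidate, so [C] may be
    empty. *)
Definition arc_rank (C : finType) (c v : seq C) (k : nat) : nat :=
  nth 0 [seq index x v | x <- c] (k %% size c).

Lemma arc_rankE (C : finType) (x0 : C) (c v : seq C) k :
  0 < size c -> arc_rank c v k = index (nth x0 c (k %% size c)) v.
Proof. by move=> c0; rewrite /arc_rank (nth_map x0) // ltn_mod. Qed.

Lemma arc_cost_modn (C : finType) (c v : seq C) l i :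
  arc_cost (arc_rank c v) l (i + size c) = arc_cost (arc_rank c v) l i.
Proof.
set w := arc_rank c v.
have wD k : w (k + size c) = w k by rewrite /w /arc_rank modnDr.
have iD j n : iota (j + size c) n = [seq k + size c | k <- iota j n].
  by rewrite addnC iotaDl; apply: eq_map => k; rewrite addnC.
elim: l i => //= l IH i; rewrite -addSn !IH; congr (minn (_ + _) (_ + _)).
  rewrite /gain_right iD count_map; apply: eq_count => k /=.
  by rewrite addnAC !wD.
rewrite /gain_left -addSn iD count_map; apply: eq_count => k /=.
by rewrite !wD.
Qed.

Lemma arc_uniq (C : finType) (x0 : C) (c : seq C) i l :
  uniq c -> l <= size c -> uniq (arc x0 c i l).
Proof.
move=> Uc lc; rewrite map_inj_in_uniq ?iota_uniq // => j k.
rewrite !mem_iota => /andP[ij ji] /andP[ik ki].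
have c0 : 0 < size c by lia.
move/(congr1 (index^~ c)); rewrite !index_uniq ?ltn_mod // => E.
have := divn_eq j (size c); have := divn_eq k (size c); rewrite E.
move: (j %/ _) (k %/ _) (k %% _) => q q' r Ek Ej.
(* Positions with equal remainders and different quotients are at least [size c] apart, too far for
   a window of length [l]. *)
have [qq|qq|qq] := ltngtP q q'; nia.
Qed.

Lemma arc_rcons (C : finType) (x0 : C) (c : seq C) i l :
  arc x0 c i l.+1 = rcons (arc x0 c i l) (nth x0 c ((i + l) %% size c)).
Proof. by rewrite /arc -(addn1 l) iotaD map_cat cats1. Qed.

Lemma arc_cons (C : finType) (x0 : C) (c : seq C) i l :
  arc x0 c i l.+1 = nth x0 c (i %% size c) :: arc x0 c i.+1 l.
Proof. by []. Qed.

Lemma arc_modn (C : finType) (x0 : C) (c : seq C) i l :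
  arc x0 c (i + size c) l = arc x0 c i l.
Proof.
rewrite /arc addnC iotaDl -map_comp; apply: eq_map => k /=.
by rewrite modnDl.
Qed.

Lemma gain_right_arc (C : finType) (x0 : C) (c v : seq C) l i : 0 < size c ->
  gain_right (arc_rank c v) l i
    = count (prefers v (nth x0 c ((i + l) %% size c))) (arc x0 c i l).
Proof.
move=> c0; rewrite /gain_right count_map; apply: eq_count => k /=.
by rewrite !(arc_rankE x0).
Qed.

Lemma gain_left_arc (C : finType) (x0 : C) (c v : seq C) l i : 0 < size c ->
  gain_left (arc_rank c v) l i
    = count (prefers v (nth x0 c (i %% size c))) (arc x0 c i.+1 l).
Proof.
move=> c0; rewrite /gain_left count_map; apply: eq_count => k /=.
by rewrite !(arc_rankE x0).
Qed.

Lemma next_nth_modn (C : finType) (x0 : C) (c : seq C) k :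
  uniq c -> 0 < size c ->
  next c (nth x0 c (k %% size c)) = nth x0 c (k.+1 %% size c).
Proof.
move=> Uc c0; have kc : k %% size c < size c by rewrite ltn_mod.
rewrite next_nth mem_nth // index_uniq // -addn1 -modnDml addn1.
case: c {Uc c0} kc => // y p; set r := k %% _; rewrite [size _]/= => kc.
(* At the last position [nth] runs past the tail [p] and returns its default [y], the head of the
   circle. *)
have [->|rp] := eqVneq r (size p); first by rewrite modnn /= nth_default.
by rewrite modn_small /=; [apply: set_nth_default|]; lia.
Qed.

(** * Swap distance as a number of inversions *)

(** Only pairs inside [s] count, which suits proper prefixes of a ranking; [swap_dist] would also
    see the missing candidates. *)
Definition inversions (C : finType) (v s : seq C) : nat :=
  \sum_(x <- s) \sum_(y <- s) (prefers s x y && prefers v y x).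

(** Coming last, [z] is preferred to nothing in the list and everything else is preferred to it, so
    each new inversion is an item that [v] ranks below [z]. *)
Lemma inversions_rcons (C : finType) (v s : seq C) z : z \notin s ->
  inversions v (rcons s z) = inversions v s + count (prefers v z) s.
Proof.
move=> zs; rewrite /inversions -cats1 big_cat big_seq1 /=.
have iz : index z (s ++ [:: z]) = size s.
  by rewrite index_cat (negbTE zs) /= eqxx addn0.
have is_ x : x \in s -> index x (s ++ [:: z]) = index x s.
  by rewrite index_cat => ->.
rewrite [X in _ + X]big1_seq ?addn0; last first.
  move=> y /andP[_]; rewrite mem_cat inE => ys; rewrite /prefers iz.
  have : index y (s ++ [:: z]) <= size s.
    case/orP: ys => [ys|/eqP->]; last by rewrite iz.
    by rewrite is_ // index_size.
  by rewrite leqNgt => /negbTE->.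
rewrite -sum1_count [X in _ = _ + X]big_mkcond -big_split /=.
rewrite big_seq [RHS]big_seq; apply: eq_bigr => x xs.
rewrite big_cat big_seq1 /=; congr (_ + _).
  by rewrite big_seq [RHS]big_seq; apply: eq_bigr => y ys; rewrite /prefers !is_.
by rewrite /prefers iz is_ // index_mem xs /=; case: ifP.
Qed.

(** A pair on which [u] and [v] disagree has a single orientation agreeing with [u], so sending
    [(a, b)] to [[set a; b]] is injective on [F]. *)
Lemma swap_dist_inversions (C : finType) (u : #|C|.-tuple C) (v : seq C) :
  uniq u -> swap_dist u v = inversions v u.
Proof.
move=> Uu; have uT x : x \in u.
  have uC : #|u| = #|{: C}| by rewrite (card_uniqP Uu) size_tuple.
  by rewrite (subset_cardP uC (subset_predT _)).
set F := [set p : C * C | prefers u p.1 p.2 && prefers v p.2 p.1].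
have -> : swap_dist u v = #|[set [set p.1; p.2] | p in F]|.
  apply: eq_card => P; rewrite !inE; apply/idP/imsetP.
    case/existsP=> a /existsP[b /and3P[/eqP-> ab ba]].
    by exists (a, b); rewrite // inE ab.
  case=> -[a b]; rewrite inE => /andP[ab ba] ->.
  by apply/existsP; exists a; apply/existsP; exists b; rewrite eqxx ab.
rewrite card_in_imset => [|[a b] [a' b']]; last first.
  rewrite !inE /= /prefers => /andP[ab _] /andP[ab' _] /setP E.
  have := E a; rewrite !inE eqxx => /esym/orP[]/eqP Ea.
    have := E b; rewrite !inE eqxx orbT Ea => /esym/orP[]/eqP Eb //.
      by move: ab; rewrite Ea Eb ltnn.
    by rewrite Eb.
  have := E b; rewrite !inE eqxx orbT => /esym/orP[]/eqP Eb.
    by move: ab ab'; rewrite Ea Eb; lia.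
  by move: ab; rewrite Ea Eb ltnn.
have big_u (f : C -> nat) : \sum_(x <- u) f x = \sum_x f x.
  rewrite big_uniq //; apply: eq_bigl => x; exact: uT.
rewrite /inversions big_u -sum1_card (eq_bigr _ (fun x _ => big_u _)).
rewrite pair_bigA big_mkcond /=; apply: eq_bigr => -[a b] _.
by rewrite inE /=; case: ifP.
Qed.

(** * Connected sets and arcs *)

Lemma connected_in_arc (C : finType) (x0 : C) (c s : seq C) i l :
  uniq c -> 0 < size c -> s =i arc x0 c i l ->
  connected_in (cycle_graph c) [set x in s].
Proof.
move=> Uc c0 sA; set S := [set _ in _].
pose r := [rel a b | [&& a \in S, b \in S & cycle_graph c a b]].
rewrite -[connected_in _ _]/[forall x in S, forall y in S, connect r x y].
have rC : symmetric r.
  by move=> a b; rewrite /r [LHS]/= cycle_graph_sym andbCA.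
pose a k := nth x0 c ((i + k) %% size c).
have aS k : k < l -> a k \in S.
  move=> kl; rewrite inE sA; apply/mapP; exists (i + k) => //.
  by rewrite mem_iota leq_addr ltn_add2l.
have a0 k : k < l -> connect r (a 0) (a k).
  elim: k => [|k IH] kl; first exact: connect0.
  apply: connect_trans (IH (ltnW kl)) (connect1 _).
  rewrite /r /= aS ?(ltnW kl) // aS // /cycle_graph /= /a.
  by rewrite next_nth_modn // addnS eqxx.
have zS x : x \in S -> connect r (a 0) x.
  rewrite inE sA => /mapP[j]; rewrite mem_iota => /andP[ij ji] ->.
  by rewrite -(subnKC ij); apply: a0; lia.
apply/forall_inP=> x xS; apply/forall_inP=> y yS.
apply: connect_trans (zS y yS); rewrite (sym_connect_sym rC).
exact: zS.
Qed.

(** The new candidate needs a neighbour in the arc, hence sits just before or just after it.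
    Starting the arc at [i.+1] lets the former position be written without subtraction. *)
Lemma connected_in_arc_extend (C : finType) (x0 : C) (c s : seq C) x i l :
  uniq c -> x \notin s -> x \in c -> 0 < l -> s =i arc x0 c i.+1 l ->
  connected_in (cycle_graph c) [set y in rcons s x] ->
  x = nth x0 c (i %% size c) \/ x = nth x0 c ((i.+1 + l) %% size c).
Proof.
move=> Uc xs xc l0 sA conn.
have c0 : 0 < size c by case: (c) xc.
set S := [set _ in _] in conn.
pose r := [rel a b | [&& a \in S, b \in S & cycle_graph c a b]].
have [z zs xz] : exists2 z, z \in s & cycle_graph c x z.
  have [/exists_inP//|noz] := boolP [exists z in s, cycle_graph c x z].
  move: noz; rewrite negb_exists_in => /forall_inP noz; exfalso.
  pose y := nth x0 c (i.+1 %% size c).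
  have ys : y \in s by rewrite sA; case: (l) l0 => // l' _; apply: mem_head.
  have xS : x \in S by rewrite inE mem_rcons mem_head.
  have yS : y \in S by rewrite inE mem_rcons inE ys orbT.
  move/forall_inP/(_ x xS)/forall_inP/(_ y yS): conn.
  (* Without a neighbour of [x] in [s], a path from [x] inside [S] never leaves [x], so it cannot
     reach [y]. *)
  case/connectP=> p; elim: p => [|z p IH] /=.
    by move=> _ yx; rewrite -yx ys in xs.
  case/andP=> /and3P[_ zS xz]; move: zS; rewrite inE mem_rcons inE.
  by case/predU1P=> [->|/noz]; [exact: IH|rewrite xz].
move: zs; rewrite sA => /mapP[k]; rewrite mem_iota => /andP[ik ki] zk.
have a_s j : i < j < i.+1 + l -> x != nth x0 c (j %% size c).
  move=> ij; apply: contraNneq xs => ->; rewrite sA; apply/mapP; exists j => //.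
  by rewrite mem_iota.
(* As [z] is at position [k], [x] is at the previous or at the next position; [a_s] excludes those
   still inside the arc. *)
move: xz; rewrite /cycle_graph /= => /orP[]/eqP Ez.
  case: k => [//|k] in ik ki zk *.
  have xk : x = nth x0 c (k %% size c).
    by rewrite -(prev_next Uc x) Ez zk -next_nth_modn // prev_next.
  have [<-|ik'] := eqVneq k i; first by left.
  by case/eqP: (a_s k ltac:(lia)).
have xk : x = nth x0 c (k.+1 %% size c) by rewrite -Ez zk next_nth_modn.
have [<-|ik'] := eqVneq k.+1 (i.+1 + l); first by right.
by case/eqP: (a_s k.+1 ltac:(lia)).
Qed.

(** * The distance as the least arc cost *)

(** Following the branch taken by each [minn] and appending the corresponding candidate yields a
    SPOC ranking with exactly [arc_cost] inversions. *)
Lemma swap_dom_SPOC_le_arc_cost (C : finType) (c v : #|C|.-tuple C) i :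
  uniq c -> swap_dom (SPOC c) v <= arc_cost (arc_rank c v) #|C| i.
Proof.
move=> Uc; have cD := mem_SPOC_arrangement Uc.
have [|_ le_dom] := @swap_domP _ (SPOC c) v; first by apply/set0Pn; exists c.
have [C0|C0] := posnP #|C|.
  apply: leq_trans (le_dom c cD) _.
  have := swap_dist_le c v; rewrite [X in 'C(X, 2)]C0 leqn0 => /eqP->.
  exact: leq0n.
have [x0 _] : exists x0 : C, true by case/card_gt0P: C0 => x0; exists x0.
have c0 : 0 < size c by rewrite size_tuple.
(* The start varies because a left extension begins from the arc at [i.+1]. The last clause, that
   all prefixes are arcs, will give single-peakedness. *)
have build l : l <= #|C| -> forall i, exists s : seq C,
    [/\ perm_eq s (arc x0 c i l),
        inversions v s = arc_cost (arc_rank c v) l i &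
        forall t, t <= l -> exists j, take t s =i arc x0 c j t].
  elim: l => [_ j|l IH lC j].
    exists [::]; split=> //; first by rewrite /inversions big_nil.
    by case=> // _; exists 0.
  have last s k : perm_eq s (arc x0 c k l.+1) ->
      (forall t, t <= l -> exists j, take t s =i arc x0 c j t) ->
      forall t, t <= l.+1 -> exists j, take t s =i arc x0 c j t.
    move=> sA arcs t; rewrite leq_eqVlt => /predU1P[->|/arcs//].
    exists k; rewrite take_oversize ?(perm_size sA) ?size_map ?size_iota //.
    exact: perm_mem.
  have takeE s x k t : perm_eq s (arc x0 c k l) -> t <= l ->
      take t (rcons s x) = take t s.
    move=> sA tl; rewrite -cats1 takel_cat //.
    by rewrite (perm_size sA) size_map size_iota.
  have notin s x k : perm_eq s (arc x0 c k l) ->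
      uniq (x :: arc x0 c k l) -> x \notin s.
    by move=> sA /andP[]; rewrite (perm_mem sA).
  have UA := arc_uniq x0 j Uc; rewrite size_tuple in UA.
  have {}UA := UA _ lC.
  rewrite /= /minn; case: ifP => _.
    have [s [sA sI arcs]] := IH (ltnW lC) j.
    set x := nth x0 c ((j + l) %% size c).
    have sxA : perm_eq (rcons s x) (arc x0 c j l.+1).
      by rewrite arc_rcons -!cats1 perm_cat2r.
    exists (rcons s x); split=> //.
      rewrite inversions_rcons; last first.
        by apply: notin sA _; rewrite cons_uniq -rcons_uniq -arc_rcons.
      by rewrite sI (gain_right_arc x0) // (permP sA).
    by apply: last sxA _ => t tl; rewrite (takeE _ _ _ _ sA tl); apply: arcs.
  have [s [sA sI arcs]] := IH (ltnW lC) j.+1.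
  set x := nth x0 c (j %% size c).
  have sxA : perm_eq (rcons s x) (arc x0 c j l.+1).
    by rewrite arc_cons perm_rcons perm_cons.
  exists (rcons s x); split=> //.
    rewrite inversions_rcons; last by apply: notin sA _.
    by rewrite sI (gain_left_arc x0) // (permP sA).
  by apply: last sxA _ => t tl; rewrite (takeE _ _ _ _ sA tl); apply: arcs.
have [s [sA <- arcs]] := build _ (leqnn _) i.
have sC : size s == #|C| by rewrite (perm_size sA) size_map size_iota.
have Us : uniq s by rewrite (perm_uniq sA) arc_uniq // size_tuple.
pose u := Tuple sC; rewrite -[s]/(val u) -swap_dist_inversions //.
apply: le_dom; rewrite !inE Us; apply/forallP => t.
have [j tA] := arcs t.+1 (ltn_ord t).
exact: connected_in_arc Uc c0 tA.
Qed.

(** By induction, each prefix of [u] is an arc whose [arc_cost], minimising over both extensions, is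
    at most the inversions of that prefix. *)
Lemma arc_cost_le_swap_dist (C : finType) (c v u : #|C|.-tuple C) :
  0 < #|C| -> uniq c -> u \in SPOC c ->
  exists2 i, i < #|C| & arc_cost (arc_rank c v) #|C| i <= swap_dist u v.
Proof.
move=> C0 Uc; rewrite !inE => /andP[Uu /forallP peak].
have [x0 _] : exists x0 : C, true by case/card_gt0P: C0 => x0; exists x0.
have c0 : 0 < size c by rewrite size_tuple.
have cT x : x \in c.
  have cC : #|c| = #|{: C}| by rewrite (card_uniqP Uc) size_tuple.
  by rewrite (subset_cardP cC (subset_predT _)).
rewrite swap_dist_inversions //.
suff build l : l <= #|C| -> exists i, [/\ i < #|C|,
    perm_eq (take l u) (arc x0 c i l) &
    arc_cost (arc_rank c v) l i <= inversions v (take l u)].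
  have [i [iC _ le_i]] := build _ (leqnn _).
  by exists i; rewrite // take_oversize ?size_tuple in le_i.
elim: l => [_|l IH lC]; first by exists 0; rewrite take0.
have [i [iC iA le_i]] := IH (ltnW lC).
have lu : l < size u by rewrite size_tuple.
rewrite (take_nth x0 lu); set x := nth x0 u l.
have xs : x \notin take l u.
  have : uniq (take l.+1 u) by apply: take_uniq.
  by rewrite (take_nth x0 lu) rcons_uniq => /andP[].
rewrite inversions_rcons // (permP iA).
have := peak (Ordinal lC); rewrite /= (take_nth x0 lu) -/x => conn.
(* The start of the empty arc is arbitrary; the top candidate fixes the first actual start. *)
have [l0|l0] := posnP l.
  subst l; exists (index x c); split.
  - by have := cT x; rewrite -index_mem size_tuple.
  - by rewrite take0 /arc /= modn_small ?index_mem ?nth_index ?cT.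
  - by [].
(* The predecessor of [i] on the circle. If [i] is [0], then [i'.+1] is [#|C|], identified with [0]
   by periodicity. *)
pose i' := if i is i0.+1 then i0 else #|C|.-1.
have i'C : i' < #|C| by rewrite /i'; case: (i) iC => [|i0] /=; lia.
have Di' k : arc_cost (arc_rank c v) k i'.+1 = arc_cost (arc_rank c v) k i.
  rewrite /i'; case: (i) => [|//]; rewrite prednK //.
  by rewrite -[RHS]arc_cost_modn add0n size_tuple.
have Ai' k : arc x0 c i'.+1 k = arc x0 c i k.
  rewrite /i'; case: (i) => [|//]; rewrite prednK //.
  by rewrite -[RHS]arc_modn add0n size_tuple.
have si' : take l u =i arc x0 c i'.+1 l by rewrite Ai'; apply: perm_mem.
have [xE|xE] := connected_in_arc_extend Uc xs (cT x) l0 si' conn.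
  exists i'; split=> //.
    by rewrite arc_cons perm_rcons -xE perm_cons Ai'.
  rewrite /= geq_min; apply/orP; right; apply: leq_add; first by rewrite Di'.
  by rewrite (gain_left_arc x0) // -xE Ai'.
(* The right end is known relative to [i'.+1]; comparing the last items of two equal arcs expresses
   it relative to [i]. *)
have {}xE : x = nth x0 c ((i + l) %% size c).
  have := Ai' l.+1; rewrite !arc_rcons => /(congr1 (last x0)).
  by rewrite !last_rcons -xE.
exists i; split=> //.
  by rewrite arc_rcons -xE -!cats1 perm_cat2r.
rewrite /= geq_min; apply/orP; left; apply: leq_add => //.
by rewrite (gain_right_arc x0) // -xE.
Qed.

(** * Total correctness with a time budget *)

Definition wp (p : cmd) (k : nat) (Q : state -> Prop) (s : state) : Prop :=
  exists t s', [/\ exec p s t s', t <= k & Q s'].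

Lemma wp_set x e k (Q : state -> Prop) s : ecost e < k ->
  Q (State (upd (reg s) x (eval s e)) (arr s)) -> wp (Set_ x e) k Q s.
Proof. by move=> ek Qs; do 2!eexists; split; [apply: ExecSet| |]. Qed.

Lemma wp_put a e1 e2 k (Q : state -> Prop) s : ecost e1 + ecost e2 < k ->
  Q (State (reg s) (upd (arr s) a (upd (arr s a) (eval s e1) (eval s e2)))) ->
  wp (Put a e1 e2) k Q s.
Proof. by move=> ek Qs; do 2!eexists; split; [apply: ExecPut| |]. Qed.

Lemma wp_seq p q k1 k2 k (Q : state -> Prop) s : k1 + k2 <= k ->
  wp p k1 (wp q k2 Q) s -> wp (Seq p q) k Q s.
Proof.
move=> le_k [t1 [s1 [Ep le1 [t2 [s2 [Eq le2 Qs]]]]]].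
exists (t1 + t2), s2; split=> //; first exact: ExecSeq Ep Eq.
exact: leq_trans (leq_add le1 le2) le_k.
Qed.

Lemma wp_weaken p k k' (Q Q' : state -> Prop) s : k <= k' ->
  (forall s', Q s' -> Q' s') -> wp p k Q s -> wp p k' Q' s.
Proof.
move=> le_k QQ' [t [s' [Ep le_t Qs]]]; exists t, s'; split=> //.
  exact: leq_trans le_t le_k.
exact: QQ'.
Qed.

(** Rule for counted loops: a test of value [n - j] succeeds exactly in rounds [j < n]. The last
    summand of the budget pays for the failing test. *)
Lemma wp_while e p k n (I : nat -> state -> Prop) s :
  (forall j s', I j s' -> eval s' e = n - j) ->
  (forall j s', j < n -> I j s' -> wp p k (I j.+1) s') ->
  I 0 s -> wp (While e p) (n * (ecost e + k).+1 + (ecost e).+1) (I n) s.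
Proof.
move=> test body.
have loop d j s' : j + d = n -> I j s' ->
    wp (While e p) (d * (ecost e + k).+1 + (ecost e).+1) (I n) s'.
  elim: d j s' => [|d IH] j s' jd Is.
    rewrite addn0 in jd; subst j.
    exists (ecost e).+1, s'; split=> //.
    by apply: ExecWhileF; rewrite (test _ _ Is) subnn.
  have jn : j < n by rewrite -jd -addSnnS leq_addr.
  have [t1 [s1 [Ep le1 I1]]] := body _ _ jn Is.
  have [|t2 [s2 [Ew le2 I2]]] := IH j.+1 s1 _ I1; first by rewrite addSnnS.
  exists (ecost e + t1 + t2).+1, s2; split=> //.
    apply: ExecWhileT Ep Ew.
    by rewrite (test _ _ Is) subn_eq0 -ltnNge.
  by rewrite mulSn -addSn -addnA; apply: leq_add; rewrite // ltnS leq_add2l.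
by move=> Is; apply: loop Is.
Qed.

(** * The program *)

(** Truncated subtraction makes [a - (a - b)] the minimum and, below, [1 - (1 - (b - a))] the
    indicator of [a < b], without branching. *)
Definition min_expr (e1 e2 : expr) : expr := Defs.Sub e1 (Defs.Sub e1 e2).

Definition less_expr (e1 e2 : expr) : expr :=
  Defs.Sub (Cst 1) (Defs.Sub (Cst 1) (Defs.Sub e2 e1)).

Lemma subn_less a b : 1 - (1 - (b - a)) = (a < b).
Proof. by case: ltnP; lia. Qed.

Definition Incr (x : nat) : cmd := Set_ x (Add (Var x) (Cst 1)).

Definition double_size : expr := Add (Var 0) (Var 0).

(* Array 2 receives the inverse of the ranking in array 1. *)
Definition rank_prog : cmd :=
  Seq (Set_ 1 (Cst 0))
    (While (Defs.Sub (Var 0) (Var 1))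
       (Seq (Put 2 (Get 1 (Var 1)) (Var 1)) (Incr 1))).

(* The ranks met when going twice around the circle are stored in array 3, so
   that no index has to be reduced modulo the number of candidates. *)
Definition unroll_prog : cmd :=
  Seq (Set_ 1 (Cst 0))
    (While (Defs.Sub (Var 0) (Var 1))
       (Seq (Put 3 (Var 1) (Get 2 (Get 0 (Var 1))))
          (Seq (Put 3 (Add (Var 1) (Var 0)) (Get 2 (Get 0 (Var 1))))
             (Incr 1)))).

(** With [Var 2 = i] and [Var 1 = l], these are the two ranks [w (i + l.+1)] and [w i] compared in
    [gain_rightS] and [gain_leftS]. *)
Definition arc_end : expr := Get 3 (Add (Var 2) (Add (Var 1) (Cst 1))).
Definition arc_start : expr := Get 3 (Var 2).

(* With [Var 1 = l], arrays 4, 5 and 6 hold [arc_cost w l], [gain_right w l] and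
   [gain_left w l]; one sweep updates them in place to [l.+1].  Their entries are
   correct only at [i] with [i + l < 2 * m]. *)
Definition sweep_body : cmd :=
  Seq (Put 4 (Var 2)
         (min_expr (Add (Get 4 (Var 2)) (Get 5 (Var 2)))
              (Add (Get 4 (Add (Var 2) (Cst 1))) (Get 6 (Var 2)))))
  (Seq (Put 5 (Var 2)
          (Add (Get 5 (Add (Var 2) (Cst 1))) (less_expr arc_end arc_start)))
  (Seq (Put 6 (Var 2) (Add (Get 6 (Var 2)) (less_expr arc_start arc_end)))
       (Incr 2))).

Definition sweep_prog : cmd :=
  Seq (Set_ 2 (Cst 0))
    (Seq (While (Defs.Sub double_size (Var 2)) sweep_body) (Incr 1)).

Definition cost_prog : cmd :=
  Seq (Set_ 1 (Cst 0)) (While (Defs.Sub (Var 0) (Var 1)) sweep_prog).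

Definition minimum_prog : cmd :=
  Seq (Set_ 1 (Cst 0))
  (Seq (Set_ 3 (Get 4 (Cst 0)))
  (Seq (While (Defs.Sub (Var 0) (Var 1))
          (Seq (Set_ 3 (min_expr (Var 3) (Get 4 (Var 1)))) (Incr 1)))
       (Set_ 0 (Var 3)))).

Definition swap_SPOC_prog : cmd :=
  Seq rank_prog (Seq unroll_prog (Seq cost_prog minimum_prog)).

(** * Correctness and running time *)

(** Zero is the right value of all three tables at length [0], so they need no initialisation. *)
Definition blank (s : state) : Prop :=
  forall k, [/\ arr s 4 k = 0, arr s 5 k = 0 & arr s 6 k = 0].

Lemma wp_rank_prog (C : finType) (code : C -> 'I_#|C|) (c v : #|C|.-tuple C) :
  injective code -> uniq v ->
  wp rank_prog (15 * #|C| + 10)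
    (fun s => [/\ reg s 0 = #|C|, arr s 0 = arr (input code c v) 0, blank s &
       forall x, x \in v -> arr s 2 (code x) = index x v])
    (input code c v).
Proof.
move=> code_inj Uv; set s0 := input code c v.
apply: (@wp_seq _ _ 2 (15 * #|C| + 8)); first lia.
apply: wp_set => //; set s1 := State _ _.
pose I j s := [/\ reg s 0 = #|C|, reg s 1 = j,
  arr s 0 = arr s0 0 /\ arr s 1 = arr s0 1, blank s &
  forall x, index x v < j -> arr s 2 (code x) = index x v].
apply: (@wp_weaken _ (#|C| * 15 + 4) _ (I #|C|)); first lia.
  move=> s [s_0 _ [sc _] sb s2]; split=> // x xv; apply: s2.
  by rewrite -index_mem size_tuple in xv.
apply: (@wp_while _ _ 11) => [j s [/= -> -> //]|j s jC|]; last by [].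
case=> s_0 s_1 [s_c s_v] sb s2.
apply: (@wp_seq _ _ 4 4) => //; apply: wp_put => //; apply: wp_set => //.
split=> //=; first by rewrite /upd /= s_1 addn1.
move=> x; rewrite ltnS /upd /= s_1 s_v /=.
(* Distinct candidates have distinct codes, so round [j] writes only the cell of its own
   candidate. *)
rewrite (nth_map x) ?size_tuple // (inj_eq (@ord_inj _)) (inj_eq code_inj).
have [-> _|xj xle] := eqVneq x (nth x v j).
  by rewrite index_uniq ?size_tuple.
apply: s2; rewrite ltn_neqAle xle andbT; apply: contraNneq xj => <-.
by rewrite nth_index // -index_mem size_tuple (leq_ltn_trans xle).
Qed.

Lemma wp_unroll_prog (C : finType) (code : C -> 'I_#|C|) (c v : #|C|.-tuple C) s :
  uniq v ->
  reg s 0 = #|C| -> arr s 0 = arr (input code c v) 0 -> blank s ->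
  (forall x, x \in v -> arr s 2 (code x) = index x v) ->
  wp unroll_prog (30 * #|C| + 10)
    (fun s => [/\ reg s 0 = #|C|, blank s &
       forall k, k < #|C|.*2 -> arr s 3 k = arc_rank c v k])
    s.
Proof.
move=> Uv s0 sc sb s2; set w := arc_rank c v.
have vT x : x \in v.
  have vC : #|v| = #|{: C}| by rewrite (card_uniqP Uv) size_tuple.
  by rewrite (subset_cardP vC (subset_predT _)).
have w_modn k : w (k + #|C|) = w k by rewrite /w /arc_rank size_tuple modnDr.
apply: (@wp_seq _ _ 2 (30 * #|C| + 8)); first lia.
apply: wp_set => //; set s1 := State _ _.
pose I j s' := [/\ reg s' 0 = #|C|, reg s' 1 = j,
  arr s' 0 = arr s 0 /\ arr s' 2 = arr s 2, blank s' &
  forall k, k < j -> arr s' 3 k = w k /\ arr s' 3 (k + #|C|) = w k].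
apply: (@wp_weaken _ (#|C| * 30 + 4) _ (I #|C|)); first lia.
  move=> s' [s'0 _ _ s'b s'3]; split=> // k kC.
  have [/s'3[]//|kC'] := ltnP k #|C|.
  by rewrite -(subnK kC') w_modn; have [] := s'3 (k - #|C|); lia.
apply: (@wp_while _ _ 26) => [j s' [/= -> -> //]|j s' jC|]; last by [].
case=> s'0 s'1 [s'c s'2] s'b s'3.
apply: (@wp_seq _ _ 6 14) => //; apply: wp_put => //.
apply: (@wp_seq _ _ 8 4) => //; apply: wp_put => //.
have wj : arr s' 2 (arr s' 0 (reg s' 1)) = w j.
  rewrite s'c s'2 s'1 sc /= /w /arc_rank size_tuple modn_small //.
  have x0 : C by case: (#|C|) jC (tval c) (size_tuple c) => // n _ [].
  by rewrite !(nth_map x0) ?size_tuple // s2.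
apply: wp_set => //; split=> //=; first by rewrite /upd /= s'1 addn1.
rewrite /upd /= wj s'0 s'1 => k; rewrite ltnS leq_eqVlt.
case/predU1P=> [->|kj]; first by rewrite !eqxx; case: eqP => // ->.
have [E1 E2] := s'3 k kj.
have [->] : [/\ k == j = false, k == j + #|C| = false,
  k + #|C| == j = false & k + #|C| == j + #|C| = false] by split; lia.
by move=> -> -> ->.
Qed.

(** Entry [i] at length [l.+1] needs entry [i.+1] at length [l] and the rank at [i + l.+1], so each
    sweep loses one position at the far end. *)
Lemma wp_sweep_prog (m l : nat) (w : nat -> nat) s :
  reg s 0 = m -> reg s 1 = l ->
  (forall k, k < m.*2 -> arr s 3 k = w k) ->
  (forall k, k + l < m.*2 -> [/\ arr s 4 k = arc_cost w l k,
     arr s 5 k = gain_right w l k & arr s 6 k = gain_left w l k]) ->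
  wp sweep_prog (m * 150 + 20)
    (fun s' => [/\ reg s' 0 = m, reg s' 1 = l.+1,
       forall k, k < m.*2 -> arr s' 3 k = w k &
       forall k, k + l.+1 < m.*2 -> [/\ arr s' 4 k = arc_cost w l.+1 k,
         arr s' 5 k = gain_right w l.+1 k & arr s' 6 k = gain_left w l.+1 k]])
    s.
Proof.
move=> s0 s1 sw sD.
(* Entries below [i] are at length [l.+1], the others still at [l]; going upwards, entry [i.+1] is
   read before it is overwritten. *)
pose I i s' := [/\ reg s' 0 = m, reg s' 1 = l, reg s' 2 = i,
  forall k, k < m.*2 -> arr s' 3 k = w k &
  forall k, let l' := l + (k < i) in k + l' < m.*2 ->
    [/\ arr s' 4 k = arc_cost w l' k,
        arr s' 5 k = gain_right w l' k & arr s' 6 k = gain_left w l' k]].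
apply: (@wp_seq _ _ 2 (m * 150 + 18)); first lia.
apply: wp_set => //; apply: (@wp_seq _ _ (m.*2 * 70 + 6) 4); first lia.
apply: (@wp_weaken _ (m.*2 * 70 + 6) _ (I m.*2)) => [//|s'|].
  case=> s'0 s'1 s'2 s'w s'D; apply: wp_set => //; split=> //=.
    by rewrite /upd /= s'1 addn1.
  move=> k kl; have := s'D k; have -> : k < m.*2 by lia.
  by rewrite addn1; apply.
apply: (@wp_while _ _ 64) => [i s' [/= -> _ -> //]|i s' im|]; first by rewrite addnn.
  case=> s'0 s'1 s'2 s'w s'D.
  apply: (@wp_seq _ _ 21 42) => //; apply: wp_put => //.
  apply: (@wp_seq _ _ 20 22) => //; apply: wp_put => //.
  apply: (@wp_seq _ _ 18 4) => //; apply: wp_put => //.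
  apply: wp_set => //; split=> //=; first by rewrite /upd /= s'2 addn1.
  move=> k; rewrite /upd /= s'1 s'2; case: eqVneq => [-> {k}|ki].
    rewrite ltnSn !addn1 => il.
    have := s'D i; have := s'D i.+1; rewrite ltnn [_.+1 < _]ltnNge leqnSn /= addn0.
    case=> [|-> -> _]; first by rewrite addSnnS.
    case=> [|-> -> ->]; first by rewrite (leq_trans _ il) // ltnS leq_add2l.
    by rewrite -minnE !subn_less gain_rightS gain_leftS !s'w.
  by rewrite ltnS [k <= i]leq_eqVlt (negbTE ki); apply: s'D.
split=> // k; rewrite ltn0 addn0; exact: sD.
Qed.

Lemma wp_cost_prog (m : nat) (w : nat -> nat) s :
  reg s 0 = m -> blank s -> (forall k, k < m.*2 -> arr s 3 k = w k) ->
  wp cost_prog (m * (m * 150 + 25) + 6)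
    (fun s' => [/\ reg s' 0 = m, m = 0 -> blank s' &
       forall k, k < m -> arr s' 4 k = arc_cost w m k])
    s.
Proof.
move=> s0 sb sw.
(* The clause [l = 0 -> blank s'] serves [m = 0], where no sweep runs and the output comes from an
   untouched cell. *)
pose I l s' := [/\ reg s' 0 = m, reg s' 1 = l,
  forall k, k < m.*2 -> arr s' 3 k = w k, l = 0 -> blank s' &
  forall k, k + l < m.*2 -> [/\ arr s' 4 k = arc_cost w l k,
    arr s' 5 k = gain_right w l k & arr s' 6 k = gain_left w l k]].
apply: (@wp_seq _ _ 2 (m * (m * 150 + 25) + 4)); first lia.
apply: wp_set => //.
apply: (@wp_weaken _ (m * (m * 150 + 24) + 4) _ (I m)); first nia.
  move=> s' [s'0 _ _ s'b s'D]; split=> // k km.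
  by have [|-> _ _] := s'D k; first lia.
have -> : m * 150 + 24 = (3 + (m * 150 + 20)).+1 by lia.
apply: (@wp_while _ _ (m * 150 + 20)) => [j s' [/= -> -> //]|l s' lm|].
  case=> s'0 s'1 s'w _ s'D.
  by apply: wp_weaken (wp_sweep_prog s'0 s'1 s'w s'D) => // s2 [].
split=> // k _; rewrite /arc_cost /gain_right /gain_left; exact: sb.
Qed.

(** The witness [k] may stay unbounded, since [arc_cost] at any start bounds the distance from
    above. *)
Lemma wp_minimum_prog (m : nat) (d : nat -> nat) s :
  reg s 0 = m -> (forall k, k < m -> arr s 4 k = d k) ->
  wp minimum_prog (m * 20 + 20)
    (fun s' => [/\ m = 0 -> output s' = arr s 4 0,
       0 < m -> exists k, output s' = d k &
       forall k, k < m -> output s' <= d k])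
    s.
Proof.
move=> s0 sd.
pose I l s' := [/\ reg s' 0 = m, reg s' 1 = l, arr s' 4 = arr s 4,
  [/\ m = 0 -> reg s' 3 = arr s 4 0 & 0 < m -> exists k, reg s' 3 = d k] &
  forall k, k < l -> reg s' 3 <= d k].
apply: (@wp_seq _ _ 2 (m * 20 + 18)); first lia.
apply: wp_set => //; apply: (@wp_seq _ _ 3 (m * 20 + 15)); first lia.
apply: wp_set => //; apply: (@wp_seq _ _ (m * 20 + 10) 2); first lia.
apply: (@wp_weaken _ (m * 16 + 4) _ (I m)); first lia.
  by move=> s' [s'0 _ _ [s'3 s'3'] s'min]; apply: wp_set.
apply: (@wp_while _ _ 12) => [j s' [/= -> -> //]|l s' lm|].
  case=> s'0 s'1 s'4 [s'3 s'3'] s'min.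
  apply: (@wp_seq _ _ 8 4) => //; apply: wp_set => //; apply: wp_set => //.
  split=> //=; rewrite /upd /= ?s'1 ?addn1 // s'4 sd // -minnE.
    split=> [m0|/s'3' [k Ek]]; first by rewrite m0 in lm.
    by rewrite /minn; case: ifP => _; [exists k|exists l].
  move=> k; rewrite ltnS leq_eqVlt geq_min.
  by case/predU1P=> [->|/s'min->]; rewrite ?leqnn ?orbT.
split=> //; split=> // m0; exists 0; exact: sd.
Qed.

Theorem theorem4p4 :
  exists (p : cmd) (T : nat -> nat),
    big_O T (fun m => m ^ 2) /\
    forall (C : finType) (code : C -> 'I_#|C|) (c v : #|C|.-tuple C),
      injective code -> uniq c -> v \in linear_orders C ->
      exists (t : nat) (s : state),
        [/\ exec p (input code c v) t s,
            t <= T #|C| &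
            output s = swap_dom (SPOC c) v].
Proof.
exists swap_SPOC_prog, (fun m => m * (m * 150 + 25) + 65 * m + 50).
(* The factor is the sum of the coefficients, [150 + 25 + 65 + 50], as [1] and [m] are at most
   [m ^ 2] for [m >= 1]. *)
split; first by exists 290, 1 => m m1; rewrite -mulnn; nia.
move=> C code c v code_inj Uc; rewrite inE => Uv.
suff: wp swap_SPOC_prog (#|C| * (#|C| * 150 + 25) + 65 * #|C| + 50)
    (fun s => output s = swap_dom (SPOC c) v) (input code c v).
  by case=> t [s [Es le_t Es']]; exists t, s.
set m := #|C|; set w := arc_rank c v.
apply: (@wp_seq _ _ (15 * m + 10) (m * (m * 150 + 25) + 50 * m + 40)); first lia.
apply: wp_weaken (wp_rank_prog c code_inj Uv) => // s [s0 sc sb s2].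
apply: (@wp_seq _ _ (30 * m + 10) (m * (m * 150 + 25) + 20 * m + 30)); first lia.
apply: wp_weaken (wp_unroll_prog Uv s0 sc sb s2) => // {s0 sc sb s2}s [s0 sb sw].
apply: (@wp_seq _ _ (m * (m * 150 + 25) + 6) (m * 20 + 20)); first lia.
apply: wp_weaken (wp_cost_prog s0 sb sw) => // {s0 sb sw}s [s0 sb sd].
apply: wp_weaken (wp_minimum_prog s0 sd) => // {s0 sd}s' [out0 outE out_le].
have dom_le := swap_dom_SPOC_le_arc_cost v _ Uc.
have [m0|m0] := posnP m.
  have := dom_le 0; rewrite [X in arc_cost _ X]m0 leqn0 => /eqP->.
  by rewrite out0 //; case: (sb m0 0).
have [|[u uD dom_u] _] := @swap_domP _ (SPOC c) v.
  by apply/set0Pn; exists c; apply: mem_SPOC_arrangement.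
(* The output is at most the cost of an arc start obtained from an optimal [u]; conversely, it is
   itself an arc cost. *)
apply/eqP; rewrite eqn_leq; apply/andP; split.
  have [i im le_i] := arc_cost_le_swap_dist v m0 Uc uD.
  by rewrite dom_u (leq_trans (out_le i im)).
by have [k ->] := outE m0.
Qed.
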